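(* We have $A_0^{CFC}(q)=1$, $A_1^{CFC}(q)=1+q$, and for $n\ge 3$, $$A_{n-1}^{CFC}(q)=(2q+1)A_{n-2}^{CFC}(q)-q\,A_{n-3}^{CFC}(q).$$ Equivalently, the generating function $A^{CFC}(x):=\sum_{n\ge 1}A_{n-1}^{CFC}(q)x^n$ is $$A^{CFC}(x)=x\,\frac{1-qx}{1-(2q+1)x+qx^2}.$$
   Context: $A_{n-1}$ is the finite Coxeter group with generators $s_1,\dots,s_{n-1}$ and Coxeter diagram the path $s_1-s_2-\cdots-s_{n-1}$ (all edges with $m=3$); $A_0$ is the trivial group. For a Coxeter group $W$ with length $\ell$, an element is fully commutative (FC) if any two of its reduced expressions are related by a sequence of transpositions of adjacent commuting generators. A cyclic shift of a word $s_{i_1}\cdots s_{i_k}$ is any word $s_{i_j}\cdots s_{i_k}s_{i_1}\cdots s_{i_{j-1}}$. An element is cyclically fully commutative (CFC) if every cyclic shift of every one of its reduced expressions is a reduced expression of an FC element. $W^{CFC}$ is the set of CFC elements, and $W^{CFC}(q)=\sum_{w\in W^{CFC}}q^{\ell(w)}$. *)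

(* Defs.v *)
(* MathComp, with mathcomp-classical for quotients by undecidable relations
   and for sums over classical sets. *)
From HB Require Import structures.
From Stdlib Require Import Relation_Operators.
From mathcomp Require Import all_boot all_order all_algebra.
From mathcomp Require Import mathcomp_extra boolp classical_sets fsbigop.

Set Implicit Arguments.
Unset Strict Implicit.
Unset Printing Implicit Defensive.

Import GRing.Theory.

Local Open Scope quotient_scope.

(* An entry 0 stands for m(s, t) = oo: the relation (s t)^0 = 1 is void. *)
Record coxeter_matrix (I : Type) := CoxeterMatrix {
  coxeter_mx :> I -> I -> nat;
  coxeter_mx_diag : forall s t, coxeter_mx s t = 1 <-> s = t;
  coxeter_mx_sym : forall s t, coxeter_mx s t = coxeter_mx t s
}.

(* The congruence on the free monoid generated by (s t)^m(s, t) = 1.  Since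
   s s = 1 is among the relations (case s = t), the quotient monoid is the
   group < I | (s t)^m(s, t) = 1 >. *)
Inductive coxeter_cong (I : Type) (M : coxeter_matrix I) :
    seq I -> seq I -> Prop :=
| coxeter_cong_rel s t :
    coxeter_cong M (flatten (nseq (M s t) [:: s; t])) [::]
| coxeter_cong_refl u : coxeter_cong M u u
| coxeter_cong_sym u v : coxeter_cong M u v -> coxeter_cong M v u
| coxeter_cong_trans v u w :
    coxeter_cong M u v -> coxeter_cong M v w -> coxeter_cong M u w
| coxeter_cong_cat u u' v v' :
    coxeter_cong M u u' -> coxeter_cong M v v' ->
    coxeter_cong M (u ++ v) (u' ++ v').

Section CoxeterGroup.
Variables (I : choiceType) (M : coxeter_matrix I).

Definition coxeter_congb (u v : seq I) : bool := `[< coxeter_cong M u v >].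

Lemma coxeter_congb_refl : reflexive coxeter_congb.
Proof. by move=> u; apply/asboolP; apply: coxeter_cong_refl. Qed.

Lemma coxeter_congb_sym : symmetric coxeter_congb.
Proof. by move=> u v; apply/asboolP/asboolP; apply: coxeter_cong_sym. Qed.

Lemma coxeter_congb_trans : transitive coxeter_congb.
Proof.
move=> v u w /asboolP uv /asboolP vw; apply/asboolP.
exact: coxeter_cong_trans uv vw.
Qed.

Canonical coxeter_equiv :=
  EquivRel coxeter_congb coxeter_congb_refl coxeter_congb_sym
    coxeter_congb_trans.

Definition coxeter_group := {eq_quot coxeter_equiv}.
HB.instance Definition _ : EqQuotient _ coxeter_equiv coxeter_group :=
  EqQuotient.on coxeter_group.
HB.instance Definition _ := Choice.on coxeter_group.

Lemma coxeter_piP (u v : seq I) :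
  \pi_coxeter_group u = \pi_coxeter_group v <-> coxeter_cong M u v.
Proof.
split; first by move/eqquotP => /asboolP.
by move=> uv; apply/eqquotP/asboolP.
Qed.

Lemma coxeter_cong_repr (u : seq I) :
  coxeter_cong M (repr (\pi_coxeter_group u)) u.
Proof. by apply/coxeter_piP; rewrite reprK. Qed.

Definition coxeter_mul (x y : coxeter_group) : coxeter_group :=
  \pi_coxeter_group (repr x ++ repr y).
Definition coxeter_one : coxeter_group := \pi_coxeter_group [::].
Definition coxeter_inv (x : coxeter_group) : coxeter_group :=
  \pi_coxeter_group (rev (repr x)).

Lemma coxeter_mulE (u v : seq I) :
  coxeter_mul (\pi u) (\pi v) = \pi_coxeter_group (u ++ v).
Proof.
by apply/coxeter_piP; apply: coxeter_cong_cat; apply: coxeter_cong_repr.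
Qed.

Lemma coxeter_mulA : associative coxeter_mul.
Proof.
move=> x y z; rewrite -[x]reprK -[y]reprK -[z]reprK.
by rewrite !coxeter_mulE catA.
Qed.

Lemma coxeter_mul1 : left_id coxeter_one coxeter_mul.
Proof. by move=> x; rewrite -[x]reprK coxeter_mulE. Qed.

Lemma coxeter_mulr1 : right_id coxeter_one coxeter_mul.
Proof. by move=> x; rewrite -[x]reprK coxeter_mulE cats0. Qed.

Lemma coxeter_cong_rev (u : seq I) : coxeter_cong M (rev u ++ u) [::].
Proof.
elim: u => [|s u IHu]; first exact: coxeter_cong_refl.
rewrite rev_cons cat_rcons; apply: coxeter_cong_trans IHu.
apply: coxeter_cong_cat; first exact: coxeter_cong_refl.
rewrite -[s :: s :: u]/([:: s; s] ++ u) -[X in coxeter_cong _ _ X]cat0s.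
apply: coxeter_cong_cat; last exact: coxeter_cong_refl.
have := coxeter_cong_rel M s s.
by rewrite (_ : M s s = 1)//; apply/coxeter_mx_diag.
Qed.

Lemma coxeter_mulV : left_inverse coxeter_one coxeter_inv coxeter_mul.
Proof.
move=> x; rewrite -[X in coxeter_mul _ X]reprK coxeter_mulE.
by apply/coxeter_piP/coxeter_cong_rev.
Qed.

Lemma coxeter_mulrV : right_inverse coxeter_one coxeter_inv coxeter_mul.
Proof.
move=> x; rewrite -[X in coxeter_mul X _]reprK coxeter_mulE.
by apply/coxeter_piP; rewrite -{1}[repr x]revK; apply: coxeter_cong_rev.
Qed.

HB.instance Definition _ := isGroup.Build coxeter_group
  coxeter_mulA coxeter_mul1 coxeter_mulr1 coxeter_mulV coxeter_mulrV.

Definition coxeter_gen (s : I) : coxeter_group := \pi_coxeter_group [:: s].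

Definition word_prod (u : seq I) : coxeter_group :=
  (\prod_(s <- u) coxeter_gen s)%g.

Lemma word_prodE (u : seq I) : word_prod u = \pi_coxeter_group u.
Proof.
elim: u => [|s u IHu]; rewrite /word_prod ?big_nil// big_cons.
by rewrite -/(word_prod u) IHu -[LHS]/(coxeter_mul _ _) coxeter_mulE.
Qed.

Lemma coxeter_length_subproof (w : coxeter_group) :
  exists k, `[< exists2 u, size u = k & word_prod u = w >].
Proof.
exists (size (repr w)); apply/asboolP; exists (repr w) => //.
by rewrite word_prodE reprK.
Qed.

Definition coxeter_length (w : coxeter_group) : nat :=
  ex_minn (coxeter_length_subproof w).

Definition reduced_expr (w : coxeter_group) (u : seq I) : Prop :=
  word_prod u = w /\ size u = coxeter_length w.

Variant commutation_step : seq I -> seq I -> Prop :=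
| CommutationStep u v s t of commute (coxeter_gen s) (coxeter_gen t) :
    commutation_step (u ++ [:: s; t] ++ v) (u ++ [:: t; s] ++ v).

Definition fully_commutative (w : coxeter_group) : Prop :=
  forall u v, reduced_expr w u -> reduced_expr w v ->
    clos_refl_trans (seq I) commutation_step u v.

Definition cyclically_fully_commutative (w : coxeter_group) : Prop :=
  forall u, reduced_expr w u -> forall j : nat,
    exists2 w', fully_commutative w' & reduced_expr w' (rot j u).

Local Open Scope classical_set_scope.
Local Open Scope ring_scope.

Definition CFC : set coxeter_group :=
  [set w | cyclically_fully_commutative w].

(* The sum is the intended one only when CFC is finite: a sum over an infinite
   set of nonzero terms is 0 by convention. *)
Definition CFC_poly : {poly int} :=
  \sum_(w \in CFC) ('X^(coxeter_length w) : {poly int}).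

End CoxeterGroup.

(* Generators are numbered from 0: i : 'I_m stands for s_(i+1). *)
Definition typeA_mx (m : nat) (i j : 'I_m) : nat :=
  if i == j then 1
  else if (i.+1 == j :> nat) || (j.+1 == i :> nat) then 3 else 2.

Lemma typeA_mx_diag m (i j : 'I_m) : typeA_mx i j = 1 <-> i = j.
Proof.
rewrite /typeA_mx; case: eqP => [->//|ij]; split=> // H.
by move: H; case: ifP.
Qed.

Lemma typeA_mx_sym m (i j : 'I_m) : typeA_mx i j = typeA_mx j i.
Proof. by rewrite /typeA_mx eq_sym orbC. Qed.

Definition typeA (m : nat) : coxeter_matrix 'I_m :=
  CoxeterMatrix (@typeA_mx_diag m) (@typeA_mx_sym m).

Definition A_CFC (m : nat) : {poly int} := CFC_poly (typeA m).

Local Open Scope ring_scope.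

(* Formal power series in x over R, as sequences of coefficients. *)
Definition fps (R : Type) := nat -> R.

Section FormalPowerSeries.
Variable R : comUnitRingType.
Implicit Types f g : fps R.

Definition fps_of_poly (p : {poly R}) : fps R := fun n => p`_n.

Definition fps_mul f g : fps R := fun n => \sum_(i < n.+1) f (n - i)%N * g i.

(* The first n coefficients of the inverse of f, obtained by solving
   f * g = 1 degree by degree; meaningful when f 0 is a unit. *)
Fixpoint fps_inv_coefs f (n : nat) : seq R :=
  if n is k.+1 then
    let g := fps_inv_coefs f k in
    rcons g ((f 0%N)^-1 * ((k == 0%N)%:R - \sum_(i < k) f (k - i)%N * g`_i))
  else [::].

Definition fps_inv f : fps R := fun n => (fps_inv_coefs f n.+1)`_n.

Definition fps_div f g : fps R := fps_mul f (fps_inv g).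

Lemma size_fps_inv_coefs f n : size (fps_inv_coefs f n) = n.
Proof. by elim: n => //= n IHn; rewrite size_rcons IHn. Qed.

Lemma nth_fps_inv_coefs f n i : (i < n)%N -> (fps_inv_coefs f n)`_i = fps_inv f i.
Proof.
elim: n => // n IHn; rewrite ltnS leq_eqVlt => /predU1P[->//|lt_in].
by rewrite /= nth_rcons size_fps_inv_coefs lt_in IHn.
Qed.

Lemma fps_mulV f :
  f 0%N \is a GRing.unit -> fps_mul f (fps_inv f) = fps_of_poly 1.
Proof.
move=> f0U; apply/funext => n; rewrite /fps_mul big_ord_recr /= subnn.
rewrite [X in _ + _ * X]/fps_inv /= nth_rcons size_fps_inv_coefs ltnn eqxx.
rewrite mulVKr// /fps_of_poly coef1 addrC.
under [X in _ - X + _]eq_bigr => i _ do rewrite nth_fps_inv_coefs//.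
by rewrite subrK.
Qed.

End FormalPowerSeries.

(* A^CFC(x) = \sum_(n >= 1) A_(n-1)^CFC(q) x^n, a series in x over Z[q]. *)
Definition A_CFC_series : fps {poly int} :=
  fun n => if n is k.+1 then A_CFC k else 0.

(* Main.v *)
Require Import Defs.
From Stdlib Require Import Relation_Operators.
From mathcomp Require Import all_boot all_order all_algebra.
From mathcomp Require Import boolp classical_sets fsbigop.
From mathcomp Require Import zify ring.

Set Implicit Arguments.
Unset Strict Implicit.
Unset Printing Implicit Defensive.

Import GRing.Theory.

(** The CFC elements of type A are exactly the products of pairwise distinct
generators, and these are easy to count.

A product of distinct generators is CFC.  Let the words act on the natural
numbers by adjacent transpositions.  A word avoiding the letter k preserves
the initial segment [0, k], while a word containing k exactly once moves some
point out of it (act_notin, act_once).  Hence a word u with distinct letters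
is reduced: any word with the same product uses all the letters of u, and any
reduced one is a rearrangement of u, again with distinct letters.  Since
distinctness survives rotation, only full commutativity is left, that is: two
words with distinct letters and the same product are related by commutations.
This is proved with normal forms (normal_words): going through the letters in
increasing order, the letter k is omitted, or placed after all smaller
letters, or, when k - 1 is present, before them.  Every word with distinct
letters can be brought to this form by commutations, and the action on the
naturals separates the normal forms.

A CFC element has only reduced words with distinct letters.  In a reduced
word of an FC element, between two occurrences of j there is an occurrence of
j - 1 (FC_gap_pred).  Indeed the gap between two consecutive occurrences of j
contains at least two neighbours of j, otherwise the word could be shortened
or a braid relation would apply; without j - 1, these are two occurrences of
j + 1 with no j between them, and the same argument applied to j + 1, j + 2
and so on runs out of letters.  For a CFC element this holds for gaps taken
cyclically: if j occurs twice, the two gaps around the circle provide two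
occurrences of j - 1, and descending to the letter 0 gives a contradiction.

So the CFC polynomial enumerates the normal forms by size.  With a_m this
polynomial for m generators and b_m the contribution of the normal forms that
contain the largest letter, the construction of the normal forms reads
a_(m+1) = a_m + q a_m + q b_m and b_(m+1) = q a_m + q b_m = a_(m+1) - a_m.
Eliminating b gives the recurrence, which is then multiplied out to give the
generating function. *)

(** * Action of words on the naturals by adjacent transpositions *)

Definition adj_swap (k x : nat) : nat :=
  if x == k then k.+1 else if x == k.+1 then k else x.

Definition act (u : seq nat) (x : nat) : nat := foldr adj_swap x u.

Lemma act_cat u v x : act (u ++ v) x = act u (act v x).
Proof. exact: foldr_cat. Qed.

Lemma adj_swapK k : involutive (adj_swap k).
Proof. by move=> x; rewrite /adj_swap; do !case: eqP; lia. Qed.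

Lemma adj_swap_far i j x : i.+1 < j ->
  adj_swap i (adj_swap j x) = adj_swap j (adj_swap i x).
Proof. by move=> ij; rewrite /adj_swap; do !case: eqP; lia. Qed.

Lemma adj_swap_braid i x :
  adj_swap i (adj_swap i.+1 (adj_swap i x)) =
  adj_swap i.+1 (adj_swap i (adj_swap i.+1 x)).
Proof. by rewrite /adj_swap; do !case: eqP; lia. Qed.

Lemma act_rev u : cancel (act (rev u)) (act u).
Proof.
elim: u => [|k u IHu] x //.
by rewrite rev_cons -cats1 act_cat /= IHu adj_swapK.
Qed.

(** Only the transposition of k and k + 1 moves a point across the boundary
of the initial segment [0, k]. *)
Lemma act_notin k u x : k \notin u -> (act u x <= k) = (x <= k).
Proof.
elim: u => //= i u IHu; rewrite inE negb_or => /andP[ki /IHu <-].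
by rewrite /adj_swap; do !case: eqP; lia.
Qed.

(** A single letter k crosses the boundary: the point brought to k by the
letters on the right of k is sent to k + 1, and the letters on the left cannot
bring it back. *)
Lemma act_once k a b : k \notin a -> k \notin b ->
  exists2 x, x <= k & k < act (a ++ k :: b) x.
Proof.
move=> ka kb; exists (act (rev b) k).
  by rewrite act_notin // mem_rev.
by rewrite act_cat /= act_rev /adj_swap eqxx ltnNge act_notin // ltnn.
Qed.

Lemma act_uniq k u : uniq u -> k \in u -> exists2 x, x <= k & k < act u x.
Proof.
move=> + /splitPr ku; case: ku => a b.
rewrite cat_uniq /= negb_or => /and3P[_ /andP[ka _] /andP[kb _]].
exact: act_once.
Qed.

(** * Commutation classes of words *)

(** Two generators of type A commute as soon as their indices differ by at
least 2.  Words are taken over nat, so that words over m letters are also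
words over m + 1 letters. *)
Variant far_step : seq nat -> seq nat -> Prop :=
| FarStep u v s t of (s.+1 < t) || (t.+1 < s) :
    far_step (u ++ [:: s; t] ++ v) (u ++ [:: t; s] ++ v).

Definition far_equiv := clos_refl_trans (seq nat) far_step.

Lemma far_equiv_sym u v : far_equiv u v -> far_equiv v u.
Proof.
elim=> {u v} [_ _ [u v s t st]|u|u v w _ vu _ wv].
- by apply: rt_step; constructor; rewrite orbC.
- exact: rt_refl.
- exact: rt_trans wv vu.
Qed.

Lemma far_equiv_cat a b u v :
  far_equiv u v -> far_equiv (a ++ u ++ b) (a ++ v ++ b).
Proof.
elim=> {u v} [_ _ [u v s t st]|u|u v w _ uv _ vw].
- apply: rt_step.
  by rewrite -!catA !(catA a u); constructor.
- exact: rt_refl.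
- exact: rt_trans uv vw.
Qed.

Lemma far_equiv_perm u v : far_equiv u v -> perm_eq u v.
Proof.
elim=> {u v} [_ _ [u v s t st]|u|u v w _ uv _ vw] //.
- by rewrite perm_cat2l perm_cat2r (perm_catC [:: s] [:: t]).
- exact: perm_trans uv vw.
Qed.

Lemma far_equiv_act u v : far_equiv u v -> act u =1 act v.
Proof.
elim=> {u v} [_ _ [u v s t st]|u|u v w _ uv _ vw] x //.
- rewrite !act_cat; congr (act _ _) => /=.
  by case/orP: st => st; first rewrite adj_swap_far //; rewrite -adj_swap_far.
- by rewrite uv.
Qed.

Lemma far_equiv_rcons k b : (forall i, i \in b -> i.+1 < k) ->
  far_equiv (k :: b) (rcons b k).
Proof.
elim: b => [|i b IHb] lt_bk; first exact: rt_refl.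
apply: (@rt_trans _ _ _ (i :: k :: b)).
  apply: rt_step; apply: (@FarStep [::] b).
  by rewrite lt_bk ?orbT // mem_head.
rewrite rcons_cons -[rcons b k]cats0 -[k :: b]cats0.
apply: (@far_equiv_cat [:: i] [::]); apply: IHb => j jb.
by apply: lt_bk; rewrite inE jb orbT.
Qed.

(** * Normal forms of words with distinct letters *)

Definition top_in (m : nat) (v : seq nat) : bool :=
  if m is k.+1 then k \in v else false.

(** The product of distinct generators is determined by the set of letters
and, for each pair k - 1, k of letters in it, by which of the two comes first.
The new largest letter k commutes with all smaller ones but k - 1, so placing
it before or after them makes a difference only if k - 1 is present. *)
Fixpoint normal_words (m : nat) : seq (seq nat) :=
  if m is k.+1 then
    normal_words k ++ [seq rcons v k | v <- normal_words k]
      ++ [seq k :: v | v <- normal_words k & top_in k v]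
  else [:: [::]].

Lemma normal_words_lt m v : v \in normal_words m -> all (fun i => i < m) v.
Proof.
elim: m v => [|m IHm] v /=; first by rewrite inE => /eqP ->.
have W w : w \in normal_words m -> all (fun i => i < m.+1) w.
  by move/IHm; apply: sub_all => i; lia.
rewrite !mem_cat => /or3P[/W //|/mapP[w /W ? ->]|/mapP[w + ->]].
  by rewrite all_rcons ltnSn.
by rewrite mem_filter /= ltnSn => /andP[_ /W].
Qed.

Lemma normal_words_fresh m v : v \in normal_words m -> m \notin v.
Proof.
by move/normal_words_lt/allP => ltv; apply/negP => /ltv; rewrite ltnn.
Qed.

Lemma normal_words_uniq_word m v : v \in normal_words m -> uniq v.
Proof.
elim: m v => [|m IHm] v /=; first by rewrite inE => /eqP ->.
rewrite !mem_cat => /or3P[/IHm //|/mapP[w ww ->]|/mapP[w + ->]].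
  by rewrite rcons_uniq normal_words_fresh // IHm.
by rewrite mem_filter /= => /andP[_ ww]; rewrite normal_words_fresh // IHm.
Qed.

(** The largest letter m is pushed past the side that does not contain m - 1;
as the letters are distinct, at least one side does not. *)
Lemma normal_words_complete m u : uniq u -> all (fun i => i < m) u ->
  exists2 v, v \in normal_words m & far_equiv u v.
Proof.
elim: m u => [|m IHm] u uu ltu.
  exists [::] => //; case: u ltu {uu} => // *; exact: rt_refl.
have [mu|mu] := boolP (m \in u); last first.
  have [] := IHm u uu.
    apply/allP => i iu; have := allP ltu _ iu.
    by rewrite ltnS leq_eqVlt; case: eqP mu iu => [<- /negP|].
  by move=> v vm uv; exists v; rewrite //= mem_cat vm.
case/splitPr: mu uu ltu => a b uu.
rewrite all_cat /= => /and3P[lta _ ltb].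
have : uniq (m :: a ++ b).
  by rewrite -(perm_uniq (permEl (perm_catCA a [:: m] b))).
rewrite cons_uniq mem_cat negb_or => /andP[/andP[ma mb] uab].
have lt_m c : m \notin c -> all (fun i => i < m.+1) c -> all (fun i => i < m) c.
  move=> mc /allP ltc; apply/allP => i ic; have := ltc _ ic.
  by rewrite ltnS leq_eqVlt; case: eqP mc ic => [<- /negP|].
have [] := IHm (a ++ b) uab; first by rewrite all_cat !lt_m.
move=> v vm abv; have abv_perm := far_equiv_perm abv.
have far c : m \notin c -> all (fun i => i < m.+1) c -> ~~ top_in m c ->
    forall i, i \in c -> i.+1 < m.
  move=> mc ltc tc i ic; have := allP (lt_m _ mc ltc) _ ic.
  case: (m) tc => // k /=; rewrite !ltnS leq_eqVlt.
  by case: eqP ic => [-> ->|].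
have [tb|tb] := boolP (top_in m b).
- exists (m :: v).
    rewrite /= !mem_cat (map_f (cons m)) ?orbT // mem_filter vm andbT.
    case: (m) tb abv_perm => //= k kb /perm_mem <-.
    by rewrite mem_cat kb orbT.
  have ta : ~~ top_in m a.
    case: (m) tb uab => //= k kb; rewrite cat_uniq => /and3P[_ /hasPn + _].
    by apply.
  apply: (@rt_trans _ _ _ (m :: a ++ b)).
    have := far_equiv_sym (far_equiv_rcons (far _ ma lta ta)).
    by move/(@far_equiv_cat [::] b); rewrite /= cat_rcons.
  by have := @far_equiv_cat [:: m] [::] _ _ abv; rewrite !cats0.
- exists (rcons v m).
    by rewrite /= !mem_cat (map_f (rcons^~ m)) ?orbT.
  apply: (@rt_trans _ _ _ (a ++ b ++ [:: m])).
    have := far_equiv_rcons (far _ mb ltb tb).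
    by move/(@far_equiv_cat a [::]); rewrite !cats0 cats1.
  by rewrite catA -cats1; apply: (@far_equiv_cat [::]).
Qed.

(** The action detects the presence of the largest letter m, by the segment
[0, m].  If m is present, the action also detects on which side of m - 1 it
stands: for normal forms w and w' over the letters less than m, if w' contains
m - 1, it sends some x < m to m, which m :: w' then sends to m + 1, whereas
rcons w m keeps x below m + 1. *)
Lemma normal_words_inj m u v : u \in normal_words m -> v \in normal_words m ->
  act u =1 act v -> u = v.
Proof.
elim: m u v => [|m IHm] u v; first by rewrite !inE => /eqP -> /eqP ->.
have absent_present w w' : w \in normal_words m -> uniq w' -> m \in w' ->
    ~ act w =1 act w'.
  move=> wm uw' mw' eq_ww'; have [x xm] := act_uniq uw' mw'.
  by rewrite -eq_ww' ltnNge act_notin ?xm ?normal_words_fresh.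
have front_back w w' : w \in normal_words m -> w' \in normal_words m ->
    top_in m w' -> ~ act (rcons w m) =1 act (m :: w').
  move=> wm w'm tw' eq_ww'.
  have [x xm mx] : exists2 x, x < m & m <= act w' x.
    case: (m) tw' w'm => //= k kw' w'm.
    have [x] := act_uniq (normal_words_uniq_word (m := k.+1) w'm) kw'.
    by exists x.
  have mx' : act w' x = m.
    by apply/eqP; rewrite eqn_leq mx andbT act_notin ?normal_words_fresh // ltnW.
  have := eq_ww' x; rewrite -cats1 act_cat /= mx' /adj_swap eqxx.
  rewrite (ltn_eqF xm) (ltn_eqF (ltn_trans xm (ltnSn m))) => e.
  by have := @act_notin m w x (normal_words_fresh wm); rewrite e (ltnW xm) ltnn.
move=> um vm; have uu := normal_words_uniq_word um.
have uv := normal_words_uniq_word vm.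
move: um vm uu uv; rewrite /= !mem_cat.
case/or3P=> [um|/mapP[u' um ->]|/mapP[u' /[!mem_filter]/andP[tu um] ->]];
case/or3P=> [vm|/mapP[v' vm ->]|/mapP[v' /[!mem_filter]/andP[tv vm] ->]].
- by move=> _ _; apply: IHm.
- move=> _ uv /(absent_present _ _ um uv) []; by rewrite mem_rcons mem_head.
- by move=> _ uv /(absent_present _ _ um uv) []; rewrite mem_head.
- move=> uu _ e; have [] := absent_present _ _ vm uu; last by move=> x.
  by rewrite mem_rcons mem_head.
- move=> _ _ e; congr rcons; apply: IHm => // x.
  by have := e (adj_swap m x); rewrite -!cats1 !act_cat /= adj_swapK.
- by move=> _ _ /(front_back _ _ um vm tv).
- by move=> uu _ e; have [] := absent_present _ _ vm uu (mem_head _ _).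
- by move=> _ _ e; have [] := front_back _ _ vm um tu.
- move=> _ _ e; congr cons; apply: IHm => // x.
  by have := congr1 (adj_swap m) (e x); rewrite /= !adj_swapK.
Qed.

(** * Words in a Coxeter group *)

Section GeneralCoxeter.
Variables (I : choiceType) (M : coxeter_matrix I).
Implicit Types (u v : seq I) (s t : I).

Lemma word_prod_cat u v :
  word_prod M (u ++ v) = (word_prod M u * word_prod M v)%g.
Proof. exact: big_cat. Qed.

Lemma word_prod_cons s u :
  word_prod M (s :: u) = (coxeter_gen M s * word_prod M u)%g.
Proof. exact: big_cons. Qed.

Lemma word_prod_congP u v :
  word_prod M u = word_prod M v <-> coxeter_cong M u v.
Proof. by rewrite !word_prodE; apply: coxeter_piP. Qed.

Lemma coxeter_genK s : (coxeter_gen M s * coxeter_gen M s = 1)%g.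
Proof.
have /word_prod_congP := coxeter_cong_rel M s s.
rewrite (_ : M s s = 1); last exact/coxeter_mx_diag.
by rewrite /= !word_prod_cons /word_prod big_nil mulg1.
Qed.

Lemma coxeter_gen_commute s t :
  M s t = 2 -> commute (coxeter_gen M s) (coxeter_gen M t).
Proof.
move=> st; have /word_prod_congP := coxeter_cong_rel M s t.
rewrite st /= !word_prod_cons /word_prod big_nil mulg1 => e.
(* Multiply the relation stst = 1 by ts on the right. *)
have: (coxeter_gen M s * (coxeter_gen M t * (coxeter_gen M s *
    (coxeter_gen M t * coxeter_gen M t * coxeter_gen M s)))
    = coxeter_gen M t * coxeter_gen M s)%g.
  by rewrite -[RHS]mul1g -[in RHS]e !mulgA.
by rewrite coxeter_genK mul1g coxeter_genK mulg1.
Qed.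

Lemma coxeter_gen_braid s t : M s t = 3 ->
  (coxeter_gen M s * (coxeter_gen M t * coxeter_gen M s)
    = coxeter_gen M t * (coxeter_gen M s * coxeter_gen M t))%g.
Proof.
move=> st; have /word_prod_congP := coxeter_cong_rel M s t.
rewrite st /= !word_prod_cons /word_prod big_nil mulg1 => e.
set S := coxeter_gen M s in e *; set T := coxeter_gen M t in e *.
have SS : (S * S = 1)%g by exact: coxeter_genK.
have TT : (T * T = 1)%g by exact: coxeter_genK.
(* Multiply the relation ststst = 1 by tst on the right. *)
have: (S * (T * (S * (T * (S * (T * T * (S * T))))))
    = T * (S * T))%g.
  by rewrite -[RHS]mul1g -[in RHS]e !mulgA.
by rewrite TT mul1g (mulgA S S) SS mul1g TT mulg1.
Qed.

Lemma coxeter_length_le u : coxeter_length (word_prod M u) <= size u.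
Proof.
rewrite /coxeter_length; case: ex_minnP => k _; apply.
by apply/asboolP; exists u.
Qed.

Lemma reduced_expr_exists (w : coxeter_group M) : exists u, reduced_expr w u.
Proof.
rewrite /reduced_expr /coxeter_length; case: ex_minnP => k /asboolP[u <- uw] _.
by exists u.
Qed.

Lemma reduced_exprP u w :
  word_prod M u = w ->
  (forall v, word_prod M v = w -> size u <= size v) -> reduced_expr w u.
Proof.
move=> uw min_u; split=> //; apply/eqP; rewrite eqn_leq -{2}uw coxeter_length_le.
by have [v [vw <-]] := reduced_expr_exists w; rewrite min_u.
Qed.

Lemma commute_word_prod s x : (forall i, i \in x -> M s i = 2) ->
  commute (coxeter_gen M s) (word_prod M x).
Proof.
elim: x => [|i x IHx] sx; first by rewrite /word_prod big_nil; apply: commute1.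
rewrite word_prod_cons; apply: commuteM.
  by apply/coxeter_gen_commute/sx/mem_head.
by apply: IHx => j jx; apply: sx; rewrite inE jx orbT.
Qed.

Lemma commutation_step_perm u v : clos_refl_trans _ (@commutation_step _ M) u v ->
  perm_eq u v.
Proof.
elim=> {u v} [_ _ [u v s t _]|u|u v w _ uv _ vw] //.
- by rewrite perm_cat2l perm_cat2r (perm_catC [:: s] [:: t]).
- exact: perm_trans uv vw.
Qed.

(** The condition that the definition of a CFC element imposes on each
rotation of each of its reduced words. *)
Definition reduced_FC u : Prop :=
  exists2 w, fully_commutative w & @reduced_expr _ M w u.

(** Otherwise the two occurrences of s could be brought together and
cancelled, and the word would not be reduced. *)
Lemma FC_commuting_gap a y b s : reduced_FC (a ++ s :: y ++ s :: b) ->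
  ~ forall i, i \in y -> M s i = 2.
Proof.
case=> w _ [uw size_u] sy.
have: word_prod M (a ++ y ++ b) = w.
  rewrite -uw !word_prod_cat !word_prod_cons word_prod_cat word_prod_cons.
  congr (_ * _)%g; rewrite !mulgA (commute_word_prod sy) -!mulgA.
  by congr (_ * _)%g; rewrite mulgA coxeter_genK mul1g.
move=> e; have := coxeter_length_le (a ++ y ++ b).
by rewrite e -size_u !size_cat /= size_cat /=; lia.
Qed.

(** Otherwise sts could be formed and replaced by tst.  The new word is also
reduced, but has one s less, while commutations preserve the number of
occurrences of each letter. *)
Lemma FC_braid_gap a y z b s t : reduced_FC (a ++ s :: y ++ t :: z ++ s :: b) ->
  (forall i, i \in y -> M s i = 2) -> (forall i, i \in z -> M s i = 2) ->
  M s t <> 3.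
Proof.
case=> w w_FC u_red sy sz st.
have v_red : reduced_expr w (a ++ y ++ t :: s :: t :: z ++ b).
  case: u_red => uw size_u; split; last first.
    by rewrite -size_u !size_cat /= !size_cat /= !size_cat /=; lia.
  rewrite -uw !(word_prod_cat, word_prod_cons).
  congr (_ * _)%g; rewrite [in RHS]mulgA (commute_word_prod sy) -!mulgA.
  congr (_ * _)%g; rewrite (mulgA (word_prod M z)) -(commute_word_prod sz) !mulgA.
  by congr (_ * _ * _)%g; rewrite -!mulgA; apply/esym/coxeter_gen_braid.
have /permP/(_ (pred1 s)) := commutation_step_perm (w_FC _ _ u_red v_red).
rewrite !count_cat /= !count_cat /= !count_cat /= eqxx.
have ts : t == s = false.
  apply/negbTE/eqP => ts; move: st.
  by rewrite ts (_ : M s s = 1) //; exact/coxeter_mx_diag.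
rewrite ts; lia.
Qed.

End GeneralCoxeter.

(** * Products of distinct generators in type A *)

Section TypeA.
Variable m : nat.
Implicit Types (u v x y : seq 'I_m) (i j k : 'I_m).

Lemma typeA_far i j : (i.+1 < j) || (j.+1 < i) -> typeA m i j = 2.
Proof.
rewrite /= /typeA_mx => ij; case: eqP => [e|_]; first by move: ij; rewrite e; lia.
by case: ifP => //; lia.
Qed.

Lemma typeA_near i j : j = i.+1 :> nat -> typeA m i j = 3.
Proof.
rewrite /= /typeA_mx => ij; rewrite ij eqxx /=.
by case: eqP => // e; move: ij; rewrite e; lia.
Qed.

Lemma coxeter_cong_act u v :
  coxeter_cong (typeA m) u v -> act (map val u) =1 act (map val v).
Proof.
elim=> {u v} [i j|//|u v _ e|v u w _ uv _ vw|u u' v v' _ uu' _ vv'] x.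
- rewrite /= /typeA_mx; case: eqP => [->|ij]; first by rewrite /= adj_swapK.
  case: ifP => [/orP[/eqP e|/eqP e]|far] /=.
  + by rewrite -e -(adj_swap_braid i) !adj_swapK.
  + by rewrite -e (adj_swap_braid j) !adj_swapK.
  + have /orP[far'|far'] : (i.+1 < j) || (j.+1 < i).
      by have : i <> j :> nat by [move/val_inj]; move: far; lia.
    * by rewrite (adj_swap_far _ far') !adj_swapK.
    * by rewrite -(adj_swap_far _ far') !adj_swapK.
- by rewrite e.
- by rewrite uv.
- by rewrite !map_cat !act_cat vv' uu'.
Qed.

Lemma word_prod_act u v : word_prod (typeA m) u = word_prod (typeA m) v ->
  act (map val u) =1 act (map val v).
Proof. by move/word_prod_congP/coxeter_cong_act. Qed.

(** If k were missing from v, the action would preserve [0, k], which it does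
not as k occurs exactly once in u. *)
Lemma word_prod_support u v : uniq u ->
  word_prod (typeA m) u = word_prod (typeA m) v -> {subset u <= v}.
Proof.
move=> uu /word_prod_act uv k ku; rewrite -(mem_map val_inj).
apply/negPn/negP => kv; have [||x xk] := @act_uniq (val k) (map val u).
- by rewrite (map_inj_uniq val_inj).
- by rewrite (mem_map val_inj).
- by rewrite uv ltnNge act_notin ?xk.
Qed.

Lemma uniq_reduced u : uniq u ->
  reduced_expr (word_prod (typeA m) u) u.
Proof.
move=> uu; apply: reduced_exprP => // v vu.
exact/uniq_leq_size/word_prod_support.
Qed.

Lemma reduced_uniq u v : uniq u ->
  reduced_expr (word_prod (typeA m) u) v -> uniq v.
Proof.
move=> uu [vu size_v]; apply: (leq_size_uniq uu).
  by apply: word_prod_support.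
by rewrite size_v coxeter_length_le.
Qed.

(** Letters that are not less than m are dropped, which makes the passage from
words over nat to words over 'I_m total and compatible with concatenation. *)
Definition ords (v : seq nat) : seq 'I_m := pmap insub v.

Lemma ordsK u : ords (map val u) = u.
Proof. by rewrite /ords; apply: map_pK => i; rewrite valK. Qed.

Lemma val_ords (v : seq nat) : all (fun n => n < m) v -> map val (ords v) = v.
Proof.
elim: v => //= n v IHv /andP[nm vm].
by rewrite /ords /= insubT /= -/(ords v) IHv.
Qed.

Lemma far_equiv_commutation (a b : seq nat) : far_equiv a b ->
  clos_refl_trans _ (@commutation_step _ (typeA m)) (ords a) (ords b).
Proof.
elim=> {a b} [_ _ [u v s t st]|u|u v w _ uv _ vw].
- rewrite /ords !pmap_cat /=.
  case: insubP => [i _ i_s|_] /=; case: insubP => [j _ j_t|_] /=;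
    try exact: rt_refl.
  apply/rt_step/CommutationStep/coxeter_gen_commute/typeA_far.
  by rewrite i_s j_t.
- exact: rt_refl.
- exact: rt_trans uv vw.
Qed.

Lemma commutation_word_prod u v :
  clos_refl_trans _ (@commutation_step _ (typeA m)) u v ->
  word_prod (typeA m) u = word_prod (typeA m) v.
Proof.
elim=> {u v} [_ _ [u v s t st]|u|u v w _ uv _ vw] //.
- rewrite !(word_prod_cat, word_prod_cons) /word_prod !big_nil !mulg1.
  by rewrite st.
- exact: etrans uv vw.
Qed.

Lemma uniq_normal u : uniq u ->
  exists2 c, c \in normal_words m & far_equiv (map val u) c.
Proof.
move=> uu; apply: normal_words_complete.
  by rewrite (map_inj_uniq val_inj).
by apply/allP => _ /mapP[i _ ->]; apply: ltn_ord.
Qed.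

(** Two reduced words of the product have normal forms with the same action,
so they share their normal form. *)
Lemma uniq_FC u : uniq u -> fully_commutative (word_prod (typeA m) u).
Proof.
move=> uu v v' v_red v'_red.
have [c cm vc] := uniq_normal (reduced_uniq uu v_red).
have [c' c'm v'c'] := uniq_normal (reduced_uniq uu v'_red).
have cc' : c = c'.
  apply: (normal_words_inj cm c'm) => x.
  rewrite -(far_equiv_act vc) -(far_equiv_act v'c').
  by apply: word_prod_act; rewrite v_red.1 v'_red.1.
rewrite -[v]ordsK -[v']ordsK; apply: far_equiv_commutation.
by apply: rt_trans vc _; rewrite cc'; apply: far_equiv_sym.
Qed.

Lemma uniq_CFC u : uniq u ->
  cyclically_fully_commutative (word_prod (typeA m) u).
Proof.
move=> uu v /(reduced_uniq uu) uv n.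
have urot : uniq (rot n v) by rewrite rot_uniq.
by exists (word_prod (typeA m) (rot n v)); [apply: uniq_FC|apply: uniq_reduced].
Qed.

(** * Repeated letters in reduced words *)

(** In a gap between consecutive occurrences of j without j - 1, all letters
but j + 1 commute with j, so by FC_commuting_gap and FC_braid_gap the letter
j + 1 occurs at least twice.  By induction on m - j there is a j between these
two occurrences, but the gap has none. *)
Lemma FC_gap_pred a x b j : reduced_FC (typeA m) (a ++ j :: x ++ j :: b) ->
  exists2 i, i \in x & i.+1 = j :> nat.
Proof.
have [n] := ubnP (m - j); elim: n => // n IHn in a x b j *.
rewrite ltnS => mjn.
(* It suffices to consider the gap up to the first return of j. *)
have [y [z [xE jy]]] : exists y z, x ++ [:: j] = y ++ j :: z /\ j \notin y.
  elim: x {IHn} => [|i x [y [z [IHx jy]]]]; first by exists [::], [::].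
  have [->|ij] := eqVneq i j; first by exists [::], (x ++ [:: j]).
  exists (i :: y), z; rewrite /= IHx; split => //.
  by rewrite inE eq_sym (negbTE ij).
have yx i : i \in y -> i \in x.
  move=> iy; have : i \in x ++ [:: j] by rewrite xE mem_cat iy.
  rewrite mem_cat inE => /orP[//|/eqP ij].
  by rewrite -ij iy in jy.
rewrite -[j :: b]/([:: j] ++ b) (catA x) xE -catA /=; set b' := z ++ b => good.
apply: contrapT => no_pred.
have commutes i : i \in y -> i <> j.+1 :> nat -> typeA m j i = 2.
  move=> iy ij1; apply: typeA_far.
  have ij : i <> j :> nat by move/val_inj => ij; rewrite -ij iy in jy.
  have : i.+1 <> j by move=> e; apply: no_pred; exists i => //; apply: yx.
  by move: ij ij1 => /=; lia.
have [/hasP[k ky /eqP kj]|/hasPn no_succ] := boolP (has (fun k => val k == j.+1) y);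
  last first.
  apply: (FC_commuting_gap good) => i iy; apply: commutes => //.
  by apply/eqP/no_succ.
case/splitPr: ky good jy yx commutes => y1 y2 good jy yx commutes.
have succ i : i = j.+1 :> nat -> i = k by move=> e; apply: val_inj; rewrite /= e.
have no_k y' : k \notin y' -> {subset y' <= y1 ++ k :: y2} ->
    forall i, i \in y' -> typeA m j i = 2.
  move=> ky' sub i iy'; apply: commutes; first exact: sub.
  by move/succ => ik; rewrite -ik iy' in ky'.
have no_repeat a' z' c' : reduced_FC (typeA m) (a' ++ k :: z' ++ k :: c') ->
    {subset z' <= y1 ++ k :: y2} -> False.
  move=> good' sub; have [|i iz'] := IHn _ _ _ _ _ good'.
    by move: (ltn_ord k) kj => /=; lia.
  rewrite [nat_of_ord k]kj => -[] /val_inj ij; move/negP: jy; apply; apply: sub.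
  by rewrite -ij.
have [ky1|ky1] := boolP (k \in y1).
  case/splitPr: ky1 good no_repeat {jy yx commutes no_k} => a1 a2 good no_repeat.
  apply: (no_repeat (a ++ j :: a1) a2 (y2 ++ j :: b')).
    by move: good; rewrite -!catA /= -?catA.
  by move=> i ia2; rewrite !(mem_cat, inE) ia2 !orbT.
have [ky2|ky2] := boolP (k \in y2).
  case/splitPr: ky2 good no_repeat {jy yx commutes no_k} => a1 a2 good no_repeat.
  apply: (no_repeat (a ++ j :: y1) a1 (a2 ++ j :: b')).
    by move: good; rewrite -!catA /= -?catA.
  by move=> i ia2; rewrite !(mem_cat, inE) ia2 !orbT.
have good' : reduced_FC (typeA m) (a ++ j :: y1 ++ k :: y2 ++ j :: b').
  by move: good; rewrite -!catA.
apply: (FC_braid_gap good'); last exact: typeA_near.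
  by apply: no_k => // i iy; rewrite mem_cat iy.
by apply: no_k => // i iy; rewrite !(mem_cat, inE) iy !orbT.
Qed.

(** By induction on j: if j occurs twice, cut the circle at the two
occurrences; each of the two arcs contains j - 1, by FC_gap_pred applied to
the word itself and to one of its rotations. *)
Lemma CFC_uniq w u : cyclically_fully_commutative w ->
  @reduced_expr _ (typeA m) w u -> uniq u.
Proof.
move=> w_CFC u_red.
have good n : reduced_FC (typeA m) (rot n u).
  by have [w' ? ?] := w_CFC u u_red n; exists w'.
apply: count_mem_uniq => j.
suff: count_mem j u <= 1.
  by have := has_pred1 j u; rewrite has_count; case: (count_mem j u) => [|[]] // <-.
have [n] := ubnP j; elim: n => // n IHn in j *; rewrite ltnS => jn.
rewrite leqNgt; apply/negP => j_twice.
have [a [y [b uE]]] : exists a y b, u = a ++ j :: y ++ j :: b.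
  have /splitPr ju : j \in u.
    by rewrite -has_pred1 has_count; apply: leq_trans j_twice.
  case: ju j_twice => a c; rewrite count_cat /= eqxx => j_twice.
  have [/splitPr[a1 a2]|ja] := boolP (j \in a).
    by exists a1, a2, c; rewrite -catA.
  have [/splitPr[c1 c2]|jc] := boolP (j \in c); first by exists a, c1, c2.
  by move: j_twice; rewrite (count_memPn ja) (count_memPn jc).
have good0 := good 0; rewrite rot0 uE in good0.
have [i iy ij] := FC_gap_pred good0.
have good1 := good (size (a ++ j :: y)).
rewrite uE -cat_cons catA rot_size_cat cat_cons catA in good1.
have [i' i'ba i'j] := FC_gap_pred (a := [::]) good1.
have ii' : i = i' by apply: val_inj; move: ij; rewrite -i'j => -[].
have := IHn i; rewrite -ij in jn; move/(_ jn).
rewrite uE count_cat /= count_cat /=.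
have : 0 < count_mem i y by rewrite -has_count has_pred1.
have : 0 < count_mem i (b ++ a) by rewrite -has_count has_pred1 ii'.
rewrite count_cat.
by move: (count_mem i a) (count_mem i b) (count_mem i y) => p q r; lia.
Qed.

End TypeA.

(** * Enumeration of the normal forms *)

Local Open Scope ring_scope.

Lemma normal_words_uniq m : uniq (normal_words m).
Proof.
elim: m => //= m IHm.
rewrite !cat_uniq has_cat negb_or IHm !map_inj_uniq ?filter_uniq //=; first last.
- by move=> u v /rcons_inj[].
- by move=> u v [].
rewrite andbT IHm /=; apply/andP; split.
  by apply/andP; split; apply/hasPn => _ /mapP[v _ ->]; apply/negP => /normal_words_fresh;
    rewrite ?mem_rcons mem_head.
 apply/hasPn => _ /mapP[v /[!mem_filter]/andP[tv vm] ->].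
apply/negP => /mapP[w wm e].
case: w wm e => [|i w] wm /=; first by case=> v0; rewrite v0 in tv; case: (m) tv.
by case=> mi _; have := normal_words_fresh wm; rewrite -mi mem_head.
Qed.

Lemma A_CFC_normal m :
  A_CFC m = \sum_(v <- normal_words m) 'X^(size v).
Proof.
pose elt v := word_prod (typeA m) (ords m v).
have ords_uniq v : v \in normal_words m -> uniq (ords m v).
  move=> vm; rewrite -(map_inj_uniq val_inj) val_ords ?normal_words_lt //.
  exact: normal_words_uniq_word vm.
have length_elt v : v \in normal_words m -> coxeter_length (elt v) = size v.
  move=> vm; have [_ <-] := uniq_reduced (ords_uniq v vm).
  by rewrite -[in RHS](val_ords (normal_words_lt vm)) size_map.
have elt_inj : {in normal_words m &, injective elt}.
  move=> u v um vm /word_prod_act.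
  rewrite !val_ords ?normal_words_lt //; exact: normal_words_inj um vm.
have elt_uniq : uniq (map elt (normal_words m)).
  by rewrite map_inj_in_uniq ?normal_words_uniq.
have CFC_E : @CFC _ (typeA m) = [set` map elt (normal_words m)]%classic.
  apply/seteqP.
  split=> [w w_CFC|_ /mapP[v vm ->]] /=; last exact/uniq_CFC/ords_uniq.
  have [u u_red] := reduced_expr_exists w.
  have uu := CFC_uniq w_CFC u_red.
  have [c cm uc] := uniq_normal uu; apply/mapP; exists c => //.
  rewrite /elt -u_red.1 -[u in LHS]ordsK.
  exact/commutation_word_prod/far_equiv_commutation.
rewrite /A_CFC /CFC_poly CFC_E -fsbig_seq // big_map; apply: eq_big_seq => v vm.
by rewrite length_elt.
Qed.

(** The contribution to A_CFC m of the elements that involve the last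
generator; it satisfies top_weight m.+1 = A_CFC m.+1 - A_CFC m. *)
Definition top_weight (m : nat) : {poly int} :=
  \sum_(v <- normal_words m | top_in m v) 'X^(size v).

Lemma A_CFC_step m : A_CFC m.+1 = A_CFC m + 'X * A_CFC m + 'X * top_weight m.
Proof.
rewrite !A_CFC_normal /= !big_cat /= addrA !big_map !big_filter !mulr_sumr.
congr (_ + _ + _); apply: eq_bigr => v _; by rewrite ?size_rcons /= exprS.
Qed.

Lemma top_weight_step m : top_weight m.+1 = 'X * A_CFC m + 'X * top_weight m.
Proof.
rewrite /top_weight A_CFC_normal /= !big_cat /= !big_map big_filter_cond !mulr_sumr.
rewrite big_seq_cond big1 ?add0r.
  congr (_ + _); apply: eq_big => v; rewrite ?mem_rcons ?mem_head ?andbT //.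
    by rewrite size_rcons exprS.
  by rewrite exprS.
move=> v /andP[/normal_words_lt/allP h mv].
by have := h _ mv; rewrite ltnn.
Qed.

Lemma A_CFC0 : A_CFC 0 = 1.
Proof. by rewrite A_CFC_normal /= big_seq1 expr0. Qed.

Lemma A_CFC1 : A_CFC 1 = 1 + 'X.
Proof.
rewrite A_CFC_step A_CFC0 mulr1 /top_weight /=.
by rewrite big1 ?mulr0 ?addr0.
Qed.

Lemma A_CFC_rec m :
  A_CFC m.+2 = (2%:R * 'X + 1) * A_CFC m.+1 - 'X * A_CFC m.
Proof.
rewrite (A_CFC_step m.+1) top_weight_step.
have -> : 'X * A_CFC m + 'X * top_weight m = A_CFC m.+1 - A_CFC m.
  by rewrite A_CFC_step; ring.
by ring.
Qed.

(** * Division of formal power series *)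

Section Fps.
Variable R : comUnitRingType.
Implicit Types f g h : fps R.

Lemma fps_mul_trunc f g (p q : {poly R}) n :
  (forall i, (i <= n)%N -> p`_i = f i) -> (forall i, (i <= n)%N -> q`_i = g i) ->
  fps_mul f g n = (p * q)`_n.
Proof.
move=> pf qg; rewrite coefMr; apply: eq_bigr => i _.
by rewrite pf ?qg ?leq_subr // -ltnS.
Qed.

(** Up to degree n a series may be replaced by its truncation, so
associativity follows from that of the product of polynomials. *)
Lemma fps_mulA f g h : fps_mul (fps_mul f g) h = fps_mul f (fps_mul g h).
Proof.
apply/funext => n; pose trunc f := \poly_(i < n.+1) f i.
have truncE f' i : (i <= n)%N -> (trunc f')`_i = f' i.
  by rewrite coef_poly ltnS => ->.
have le_trunc f' i j : (i <= n)%N -> (j <= i)%N -> (trunc f')`_j = f' j.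
  by move=> ni ij; apply/truncE/(leq_trans ij).
have prodE f' g' i : (i <= n)%N -> (trunc f' * trunc g')`_i = fps_mul f' g' i.
  by move=> ni; symmetry; apply: fps_mul_trunc => j; apply: le_trunc.
rewrite (fps_mul_trunc (prodE f g) (truncE h)).
by rewrite (fps_mul_trunc (truncE f) (prodE g h)) mulrA.
Qed.

Lemma fps_div_uniq f g h :
  g 0%N \is a GRing.unit -> fps_mul h g = f -> h = fps_div f g.
Proof.
move=> g0 <-; rewrite /fps_div fps_mulA fps_mulV //.
apply/funext => n; rewrite /fps_mul big_ord_recl /= subn0 /fps_of_poly coef1 mulr1.
by rewrite big1 ?addr0 // => i _; rewrite coef1 mulr0.
Qed.

End Fps.

Theorem theorem2p3 :
  let q : {poly int} := 'X in
  let x : {poly {poly int}} := 'X in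
  (A_CFC 0 = 1 /\
   A_CFC 1 = 1 + q /\
   forall n : nat, (3 <= n)%N ->
     A_CFC (n - 1) = (2%:R * q + 1) * A_CFC (n - 2) - q * A_CFC (n - 3)) /\
  A_CFC_series =
    fps_div (fps_of_poly (x * (1 - q%:P * x)))
            (fps_of_poly (1 - (2%:R * q + 1)%:P * x + q%:P * x ^+ 2)).
Proof.
move=> q x; split.
  split; [exact: A_CFC0|split; first exact: A_CFC1].
  case=> [|[|[|m]]] // _.
  by rewrite !subSS !subn0; apply: A_CFC_rec.
set d := 1 - _ + q%:P * x ^+ 2.
have dE i : d`_i = [:: 1; - (2%:R * q + 1); q]`_i.
  rewrite /d coefD coefB coef1 !coefCM coefX coefXn.
  by case: i => [|[|[|i]]] /=; rewrite ?mulr1 ?mulr0 ?nth_nil; ring.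
apply: fps_div_uniq; first by rewrite /fps_of_poly dE unitr1.
apply/funext => n; rewrite /fps_mul /fps_of_poly coefXM coefB coef1 coefCM coefX.
case: n => [|[|[|n]]]; first by rewrite big_ord1 dE /= mul0r.
- by rewrite 2!big_ord_recl big_ord0 !dE /= A_CFC0; ring.
- by rewrite 3!big_ord_recl big_ord0 !dE /= A_CFC0 A_CFC1 -/q; ring.
rewrite 3!big_ord_recl big1 => [|i _]; last by rewrite dE /= nth_nil mulr0.
by rewrite !dE /= A_CFC_rec -/q; ring.
Qed.
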